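(* Let $K$ be a finite non-empty set of states, $A$ an arbitrary non-empty set of actions, $S$ an arbitrary non-empty set of signals, $q:K\times A\to\Delta_f(S\times K)$ a transition function, $g:K\times A\to[0,1]$ a reward function, and $p_0\in\Delta(K)$ an initial probability. Then the Markov decision process with partial observation $\Psi(p_0)=(K,A,S,q,g,p_0)$, played with behavioral strategies, has a uniform value.
   Context: $\Delta(K)$ is the set of probability distributions on the finite set $K$; for an arbitrary set $E$, $\Delta_f(E)$ is the set of probabilities on $E$ with finite support. The MDP $\Psi(p_0)$ is played as follows by a decision maker knowing $K,p_0,A,S,q,g$. An initial state $k_1\in K$ is selected according to $p_0$ and is not told to the decision maker. At every stage $t\geq1$ the decision maker selects an action $a_t\in A$ and has the (unobserved) payoff $g(k_t,a_t)$. Then a pair $(s_t,k_{t+1})$ is selected according to $q(k_t,a_t)$, the signal $s_t$ (only) is told to the decision maker, the new state is $k_{t+1}$, and the play goes to stage $t+1$. A behavioral strategy is a sequence $\sigma=(\sigma_t)_{t\geq1}$ with $\sigma_t:(A\times S)^{t-1}\to\Delta_f(A)$ giving the lottery used to choose the action at stage $t$ as a function of past actions and signals. Together with $p_0$ it induces a probability distribution on plays in $(K\times A\times S)^\infty$. Let $\gamma_n^{p_0}(\sigma)=\mathbb{E}_{p_0,\sigma}\left[\frac1n\sum_{t=1}^n g(k_t,a_t)\right]$ and $v_n(p_0)=\sup_\sigma\gamma_n^{p_0}(\sigma)$, the supremum being over behavioral strategies. $\Psi(p_0)$ has a uniform value if $\sup_\sigma\left(\liminf_n\gamma_n^{p_0}(\sigma)\right)=\limsup_n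 v_n(p_0)$ (supremum over behavioral strategies); equivalently, $(v_n(p_0))_n$ converges to some $v(p_0)$ and for every $\varepsilon>0$ there is a behavioral strategy $\sigma$ with $\liminf_n\gamma_n^{p_0}(\sigma)\geq v(p_0)-\varepsilon$. *)

(* Defs.v *)
From HB Require Import structures.
From mathcomp Require Import all_boot all_order all_algebra finmap.
From mathcomp Require Import all_classical all_reals all_analysis.

Set Implicit Arguments.
Unset Strict Implicit.
Unset Printing Implicit Defensive.

Import Order.TTheory GRing.Theory Num.Theory.
Local Open Scope fset_scope.
Local Open Scope ring_scope.

(* Probabilities with finite support.  When T is a finite type this is the
   whole simplex over T. *)
Record fsdist (R : realType) (T : choiceType) := FSDist {
  fsdist_fun :> {fsfun T -> R with 0} ;
  fsdist_ge0 : forall x, 0 <= fsdist_fun x ;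
  fsdist_sum1 : \sum_(x <- finsupp fsdist_fun) fsdist_fun x = 1 }.

Definition fsexp (R : realType) (T : choiceType) (p : fsdist R T) (f : T -> R)
  : R := \sum_(x <- finsupp p) p x * f x.

Section Dirac.
Variables (R : realType) (T : choiceType) (a : T).

Definition dirac_fun : {fsfun T -> R with 0} :=
  [fsfun x in [fset a] => 1 | 0].

Lemma dirac_funE x : dirac_fun x = (x == a)%:R.
Proof. by rewrite fsfun_fun in_fset1; case: (x == a). Qed.

Lemma dirac_ge0 x : 0 <= dirac_fun x.
Proof. by rewrite dirac_funE. Qed.

Lemma dirac_sum1 : \sum_(x <- finsupp dirac_fun) dirac_fun x = 1.
Proof.
have -> : finsupp dirac_fun = [fset a].
  apply/fsetP => x; rewrite mem_finsupp dirac_funE in_fset1.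
  by case: (x == a); rewrite ?oner_eq0 ?eqxx.
by rewrite big_seq_fset1 dirac_funE eqxx.
Qed.

Definition fsdirac : fsdist R T := FSDist dirac_ge0 dirac_sum1.

End Dirac.

Section Bind.
Variables (R : realType) (T U : choiceType).
Variables (p : fsdist R T) (f : T -> fsdist R U).

Definition bind_supp : {fset U} := \bigcup_(x <- finsupp p) finsupp (f x).

Definition bind_fun : {fsfun U -> R with 0} :=
  [fsfun y in bind_supp => \sum_(x <- finsupp p) p x * f x y | 0].

Lemma bind_funE y : bind_fun y = \sum_(x <- finsupp p) p x * f x y.
Proof.
rewrite fsfun_fun; case: ifPn => // yN.
rewrite big_seq big1 // => x xp.
rewrite [f x y]fsfun_dflt ?mulr0 //.
by apply: contra yN => yf; apply/bigfcupP; exists x; rewrite ?xp.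
Qed.

Lemma bind_ge0 y : 0 <= bind_fun y.
Proof.
by rewrite bind_funE sumr_ge0 // => x _; rewrite mulr_ge0 ?fsdist_ge0.
Qed.

Lemma bind_sum1 : \sum_(y <- finsupp bind_fun) bind_fun y = 1.
Proof.
have sub : finsupp bind_fun `<=` bind_supp by exact: finsupp_sub.
rewrite (big_fset_incl _ sub) => [|y _ yN]; last exact: fsfun_dflt.
under eq_bigr do rewrite bind_funE.
rewrite exchange_big /= -[RHS](fsdist_sum1 p) big_seq [RHS]big_seq.
apply: eq_bigr => x xp; rewrite -mulr_sumr -[RHS]mulr1; congr (_ * _).
rewrite -[RHS](fsdist_sum1 (f x)); apply/esym/big_fset_incl => [|y _ yN].
  by apply/fsubsetP => y yf; apply/bigfcupP; exists x; rewrite ?xp.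
exact: fsfun_dflt.
Qed.

Definition fsbind : fsdist R U := FSDist bind_ge0 bind_sum1.

End Bind.

(* A and S stand for arbitrary sets: under the axioms of boolp every type has a
   choiceType structure (gen_choiceMixin). *)
Section PartialObservationMDP.
Variables (R : realType) (K : finType) (A S : choiceType).
Variables (q : K -> A -> fsdist R (S * K)%type) (g : K -> A -> R).
Variable p0 : fsdist R K.

(* The lists of length t - 1 carry the component sigma_t. *)
Definition strategy := seq (A * S) -> fsdist R A.

(* [:: (k_1, a_1, s_1); ... ; (k_n, a_n, s_n)] *)
Definition play := seq (K * A * S).

Definition observed (h : play) : seq (A * S) :=
  [seq (x.1.2, x.2) | x <- h].

(* Joint law of the first n stages and of the state k_{n+1}, i.e. the
   marginal of the law of the infinite play induced by p0 and sigma. *)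
Fixpoint play_law (sigma : strategy) (n : nat)
  : fsdist R (play * K)%type :=
  if n is m.+1 then
    fsbind (play_law sigma m) (fun hk : play * K =>
    fsbind (sigma (observed hk.1)) (fun a : A =>
    fsbind (q hk.2 a) (fun sk : S * K =>
      fsdirac R (rcons hk.1 (hk.2, a, sk.1), sk.2))))
  else fsbind p0 (fun k : K => fsdirac R ([::] : play, k)).

Definition gamma (sigma : strategy) (n : nat) : R :=
  fsexp (play_law sigma n)
    (fun hk : play * K => n%:R^-1 * \sum_(x <- hk.1) g x.1.1 x.1.2).

(* n = 0 gives an irrelevant value: only limits in n are used below. *)
Definition value (n : nat) : \bar R :=
  ereal_sup [set (gamma sigma n)%:E | sigma in [set: strategy]].

Definition has_uniform_value : Prop :=
  ereal_sup [set limn_einf (fun n => (gamma sigma n)%:E)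
            | sigma in [set: strategy]]
  = limn_esup value.

End PartialObservationMDP.

(* Main.v *)
Require Import Defs.
From mathcomp Require Import all_boot all_order all_algebra finmap.
From mathcomp Require Import all_classical all_reals all_analysis.
From mathcomp Require Import ring lra zify.
Set Implicit Arguments.
Unset Strict Implicit.
Unset Printing Implicit Defensive.
Import Order.TTheory GRing.Theory Num.Theory.
Local Open Scope ring_scope.

(** Given a strategy, the law of the play and of the current state after [n]
    stages evolves deterministically, and the payoff of a stage is a function of
    this law and of the map from histories to lotteries used at that stage. So
    the process is a deterministic control problem whose states are laws.

    This control problem is precompact in a strong sense ([simulation_law]).
    The future after an observed history depends on it only through the belief,
    a point of the simplex over the finite set [K]. Cut the simplex into
    finitely many small cells and describe a law by the masses of the cells,
    rounded to finitely many values. If [z] and [z'] have the same description,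
    any behavior [s] after [z] is imitated after [z'] as follows: having
    observed a history whose belief lies in the cell [d], draw a history
    according to [z] conditionally on the cell [d], and play for ever as [s]
    does after that one. By Kuhn's theorem ([expected_payoff_mixture]) drawing a
    strategy at random amounts to a behavioral strategy, and the expected
    payoffs of all stages at once are close, because the expected payoff of a
    stage is linear in the belief.

    Now let [a] be below the upper limit of the values. Within a long play of
    average at least [a] there is a date from which the averages over the next
    [1], [2], ..., [n] stages are all at least [a], up to a small loss
    ([guarantee_of_average]). Since there are finitely many descriptions, such a
    date can be found before a bound [M] independent of [n] and of the initial
    law ([guarantee_early]), and after [T] good stages one can be again at a law
    with the same property ([sustainable_block]). Chaining such blocks, with
    summable losses and each block much longer than the waiting time [M] of the
    next one, gives a single play whose averages are eventually at least
    [a - e] ([uniform_play]). Hence some strategy has a lower limit of payoffs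
    close to [a]; the converse inequality is that of lower and upper limits. *)

(** * Deterministic control of precompact systems *)

Section Control.
Variables (R : realType) (Z B : Type).
Variables (next : B -> Z -> Z) (rew : B -> Z -> R).
Hypothesis rew01 : forall b z, 0 <= rew b z <= 1.

Fixpoint run (z : Z) (b : nat -> B) (n : nat) : Z :=
  if n is m.+1 then next (b m) (run z b m) else z.

Definition stage z b t : R := rew (b t) (run z b t).

Definition cumul z b n : R := \sum_(0 <= t < n) stage z b t.

Definition delay (b : nat -> B) m : nat -> B := fun t => b (m + t)%N.

Definition splice m (b b' : nat -> B) : nat -> B :=
  fun t => if (t < m)%N then b t else b' (t - m)%N.

Lemma runD z b m n : run z b (m + n) = run (run z b m) (delay b m) n.
Proof. by elim: n => [|n IH] /=; rewrite ?addn0// addnS /= IH. Qed.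

Lemma eq_run z b b' n : (forall t, (t < n)%N -> b t = b' t) ->
  run z b n = run z b' n.
Proof.
elim: n => //= n IH e; rewrite e// IH// => t tn.
by apply: e; rewrite ltnS ltnW.
Qed.

Lemma eq_stage z b b' n : (forall t, (t <= n)%N -> b t = b' t) ->
  stage z b n = stage z b' n.
Proof.
by move=> e; rewrite /stage e// (@eq_run _ b b')// => t tn; rewrite e// ltnW.
Qed.

Lemma stageD z b m n : stage z b (m + n) = stage (run z b m) (delay b m) n.
Proof. by rewrite /stage runD. Qed.

Lemma run_splice z m b b' : run z (splice m b b') m = run z b m.
Proof. by apply: eq_run => t tm; rewrite /splice tm. Qed.

Lemma delay_splice m b b' : delay (splice m b b') m = b'.
Proof.
by apply/funext => t; rewrite /delay /splice ltnNge leq_addr /= addKn.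
Qed.

Lemma stage_ge0 z b t : 0 <= stage z b t.
Proof. by case/andP: (rew01 (b t) (run z b t)). Qed.

Lemma stage_le1 z b t : stage z b t <= 1.
Proof. by case/andP: (rew01 (b t) (run z b t)). Qed.

Lemma cumul_ge0 z b n : 0 <= cumul z b n.
Proof. by apply: sumr_ge0 => t _; exact: stage_ge0. Qed.

Lemma cumul_le z b n : cumul z b n <= n%:R.
Proof.
rewrite -[n in n%:R]subn0 -sumr_const_nat /cumul.
by apply: ler_sum => t _; exact: stage_le1.
Qed.

Lemma cumulD z b m n :
  cumul z b (m + n) = cumul z b m + cumul (run z b m) (delay b m) n.
Proof.
rewrite /cumul (@big_cat_nat _ _ _ m) ?leq_addr//=; congr (_ + _).
rewrite -{1}[m]add0n big_addn addKn; apply: eq_bigr => t _.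
by rewrite addnC stageD.
Qed.

Lemma eq_cumul z b b' n : (forall t, (t < n)%N -> b t = b' t) ->
  cumul z b n = cumul z b' n.
Proof.
move=> e; apply: eq_big_nat => t /andP[_ tn]; apply: eq_stage => i it.
by apply: e; exact: leq_ltn_trans tn.
Qed.

(** The dates [t <= n] are quantified under the same play: a play that is good on
    average over [n] stages need not have good averages at earlier dates. *)
Definition guarantee z m n (a : R) := exists b, forall t, (t <= n)%N ->
  a * t%:R <= cumul (run z b m) (delay b m) t.

Definition sustainable z (a : R) := forall n, exists m, guarantee z m n a.

Lemma guarantee_run z b m m' n a :
  guarantee (run z b m) m' n a -> guarantee z (m + m') n a.
Proof.
case=> b' h; exists (splice m b b') => t tn.
move: (h t tn); rewrite runD run_splice delay_splice.
congr (_ <= cumul _ _ _); apply/funext => i.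
by rewrite /delay -addnA -/(delay _ m _) delay_splice.
Qed.

Lemma ler_guarantee z m n a a' :
  a' <= a -> guarantee z m n a -> guarantee z m n a'.
Proof.
by move=> aa' [b h]; exists b => t /h; apply: le_trans; rewrite ler_wpM2r.
Qed.

(** Otherwise every date starts a block of at most [n] stages with average below
    [a - d]; these blocks tile the [N] stages up to a rest shorter than [n], so
    the sum of payoffs stays below [(a - d) * N + n <= a * N]. *)
Lemma guarantee_of_average z b n N a d : 0 <= d -> n%:R <= d * N%:R ->
  a * N%:R <= cumul z b N -> exists m, guarantee z m n (a - d).
Proof.
move=> d0 nN aN; apply: contrapT => /forallNP no.
have [ad|ad] := lerP (a - d) 0.
  apply: (no 0%N); exists b => t _; apply: le_trans (cumul_ge0 _ _ _).
  by rewrite mulr_le0_ge0.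
have short m : exists2 t, (t <= n)%N &
    cumul (run z b m) (delay b m) t < (a - d) * t%:R.
  apply: contrapT => h; apply: (no m); exists b => t tn.
  by rewrite leNgt; apply/negP => lt; apply: h; exists t.
suff bound : forall L m, cumul (run z b m) (delay b m) L
    < (a - d) * L%:R + n%:R.
  have := bound N 0%N; rewrite (_ : delay b 0 = b) /=; last exact/funext.
  lra.
move=> L; have [k] := ubnP L; elim: k L => // k IH L; rewrite ltnS => Lk m.
have [t tn lt] := short m.
have t0 : (0 < t)%N.
  by case: t tn lt => // _; rewrite /cumul big_geq// mulr0 ltxx.
have [tL|Lt] := leqP t L; last first.
  apply: le_lt_trans (cumul_le _ _ _) _.
  have : L%:R + 1 <= n%:R :> R by rewrite natr1 ler_nat; lia.
  have : 0 <= (a - d) * L%:R by rewrite mulr_ge0// ltW.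
  lra.
rewrite -(subnKC tL) cumulD -runD natrD mulrDr.
rewrite (_ : delay (delay b m) t = delay b (m + t)); last first.
  by apply/funext => i; rewrite /delay addnA.
have := IH (L - t)%N _ (m + t)%N; rewrite -/(_ < _)%N.
move=> /(_ ltac:(lia)); lra.
Qed.

(** Precompactness: up to [e], finitely many states represent all sets of payoff
    streams. The same [b'] must serve all stages, so that averages over all
    horizons, and from all starting dates, are close. *)
Hypothesis simulation : forall e : R, 0 < e ->
  exists (D : finType) (c : Z -> D), forall z z', c z = c z' ->
  forall b, exists b', forall t, `|stage z b t - stage z' b' t| <= e.

Lemma cumul_close z z' b b' (e : R) n :
  (forall t, `|stage z b t - stage z' b' t| <= e) ->
  cumul z b n - e * n%:R <= cumul z' b' n.
Proof.
move=> h; elim: n => [|n]; first by rewrite /cumul !big_geq// mulr0 subr0.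
rewrite /cumul !big_nat_recr//= -/(cumul _ _ _) -/(cumul z' _ _) -natr1.
by have := h n; rewrite ler_norml => /andP[_]; lra.
Qed.

Lemma guarantee_close z z' (e : R) m n a :
  (forall b, exists b', forall t, `|stage z b t - stage z' b' t| <= e) ->
  guarantee z m n a -> guarantee z' m n (a - e).
Proof.
move=> sim [b h]; have [b' bb'] := sim b; exists b' => t tn.
have := h t tn.
have: cumul (run z b m) (delay b m) t - e * t%:R
    <= cumul (run z' b' m) (delay b' m) t.
  by apply: cumul_close => i; rewrite -!stageD.
by lra.
Qed.

Lemma finite_bound (D : finType) (P : D -> nat -> Prop) :
  (forall d, exists M, P d M) ->
  exists M, forall d, exists2 m, (m <= M)%N & P d m.
Proof.
move=> /choice[f fP]; exists (\max_d f d) => d.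
by exists (f d) => //; exact: leq_bigmax.
Qed.

(** From one state, every class that can be visited can be visited before a fixed
    date, and the guarantee at a late date is imitated from that early visit. The
    bound depends on the state; applying the hypothesis once more makes it
    depend on the class of the state only, and there are finitely many. The two
    changes of initial state and the change of final state cost [e / 3] each. *)
Lemma guarantee_early (e : R) : 0 < e -> exists M, forall z m n a,
  guarantee z m n a -> exists2 m', (m' <= M)%N & guarantee z m' n (a - e).
Proof.
move=> e0; have e30 : 0 < e / 3 by lra.
have [D [c sim]] := simulation e30.
have one z : exists M, forall m n a, guarantee z m n a ->
    exists2 m', (m' <= M)%N & guarantee z m' n (a - e / 3).
  have [d|M MP] := @finite_bound D (fun d m0 => forall b m,
      c (run z b m) = d -> exists b', c (run z b' m0) = d).
    have [[m0 [b0 <-]]|no] := pselect (exists m0 b, c (run z b m0) = d).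
      by exists m0 => b m _; exists b0.
    by exists 0%N => b m bm; case: no; exists m, b.
  exists M => m n a [b h].
  have [m' m'M /(_ b m erefl)[b' b'P]] := MP (c (run z b m)).
  exists m' => //; rewrite -[m']addn0; apply: (@guarantee_run _ b').
  apply: (@guarantee_close (run z b m)); first exact: sim.
  by exists (delay b m).
have [d|M MP] := @finite_bound D (fun d M => forall z, c z = d ->
    forall m n a, guarantee z m n a ->
    exists2 m', (m' <= M)%N & guarantee z m' n (a - e)).
  have [[z0 <-]|no] := pselect (exists z0, c z0 = d); last first.
    by exists 0%N => z zd; case: no; exists z.
  have [M MP] := one z0; exists M => z zz0 m n a zm.
  have [m' m'M z0m'] := MP _ _ _ (guarantee_close (sim _ _ zz0) zm).
  exists m' => //; have := guarantee_close (sim _ _ (esym zz0)) z0m'.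
  by apply: ler_guarantee; lra.
exists M => z m n a zm.
have [M' M'M /(_ z erefl _ _ _ zm)[m' m'M' h]] := MP (c z).
by exists m' => //; exact: leq_trans M'M.
Qed.

Lemma natr_large (x : R) : exists n : nat, x <= n%:R.
Proof.
exists (Num.bound `|x|); rewrite (le_trans (ler_norm x))//.
by rewrite ltW// archi_boundP.
Qed.

(** For each [n] there is a play with a guarantee over [n] stages, starting before
    [M]. Let [y n] be the state it reaches [T] stages later. For large [n] the
    payoffs from [y n] are still high on average, hence guarantees over any given
    horizon are available from [y n]. But [y n] varies with [n], and one state
    has to serve all horizons: choose a class visited by [y n] for infinitely
    many [n]; each [y n] in this class imitates all the later ones. *)
Lemma sustainable_block (e : R) : 0 < e -> exists M, forall T z a,
  sustainable z a -> exists2 m, (m <= M)%N & exists b,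
    (forall t, (t <= T)%N -> (a - e) * t%:R <= cumul (run z b m) (delay b m) t)
    /\ sustainable (run z b (m + T)) (a - e).
Proof.
move=> e0; have e40 : 0 < e / 4 by lra.
have [M early] := guarantee_early e40; exists M => T z a za.
have /choice[f fP] : forall n, exists mb : nat * (nat -> B), (mb.1 <= M)%N /\
    forall t, (t <= n)%N ->
      (a - e / 4) * t%:R <= cumul (run z mb.2 mb.1) (delay mb.2 mb.1) t.
  move=> n; have [m zm] := za n; have [m' m'M [b h]] := early _ _ _ _ zm.
  by exists (m', b).
have [D [c sim]] := simulation e40.
pose y n := run z (f n).2 ((f n).1 + T).
have [d dP] : exists d, forall N, exists2 n, (N <= n)%N & c (y n) = d.
  apply: contrapT => /forallNP no.
  have [d|N NP] := @finite_bound D (fun d N =>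
      forall n, (N <= n)%N -> c (y n) <> d).
    have /existsNP[N NP] := no d; exists N => n Nn yd.
    by apply: NP; exists n.
  by have [N' N'N /(_ N N'N)] := NP (c (y N)).
have [n0 Tn0 yn0] := dP T; have [m0M good] := fP n0.
exists (f n0).1 => //; exists (f n0).2; split.
  move=> t tT; apply: le_trans (good t (leq_trans tT Tn0)).
  by rewrite ler_wpM2r//; lra.
move=> n.
(* This bound lets an average taken over k - T stages absorb both the payoffs of
   the first T stages and the slack required for a horizon of n stages. *)
have [N NP] := natr_large ((n%:R + T%:R * (1 + `|a| + e)) / (e / 4)).
have [k Nk yk] := dP (T + N)%N; have [_ goodk] := fP k.
have Tk : (T <= k)%N by rewrite (leq_trans _ Nk)// leq_addr.
have kN : n%:R + T%:R * (1 + `|a| + e) <= e / 4 * (k - T)%:R.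
  rewrite [e / 4 * _]mulrC -ler_pdivrMr//; apply: (le_trans NP).
  by rewrite ler_nat; lia.
have T0 : 0 <= T%:R :> R by [].
have Ta : T%:R * a <= T%:R * `|a| by rewrite ler_wpM2l// ler_norm.
have Ta' : T%:R * - a <= T%:R * `|a|.
  by rewrite ler_wpM2l// -normrN ler_norm.
have Tn : 0 <= T%:R * `|a| by rewrite mulr_ge0.
have Te : 0 <= T%:R * e by rewrite mulr_ge0// ltW.
have [m] : exists m, guarantee (y k) m n (a - e / 2 - e / 4).
  apply: (@guarantee_of_average _ (delay (delay (f k).2 (f k).1) T) _ (k - T)).
  - lra.
  - by have n0' : 0 <= n%:R :> R by []; lra.
  - have := goodk (T + (k - T))%N; rewrite cumulD -runD -/(y k).
    rewrite {1}subnKC// leqnn => /(_ isT).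
    have := cumul_le (run z (f k).2 (f k).1) (delay (f k).2 (f k).1) T.
    rewrite natrD.
    by have n0' : 0 <= n%:R :> R by []; lra.
have ykn0 : c (y k) = c (y n0) by rewrite yk yn0.
move=> /(guarantee_close (sim _ _ ykn0)) ym; exists m.
by apply: ler_guarantee ym; lra.
Qed.

Lemma sustainable_le1 z a : sustainable z a -> a <= 1.
Proof.
move=> /(_ 1%N)[m [b /(_ 1%N (leqnn _))]]; rewrite mulr1 => h.
exact: le_trans h (cumul_le _ _ _).
Qed.

(** Block [i] starts from a state that sustains [lvl i], waits at most [M i]
    stages, then yields at least [lvl i.+1 >= a - e / 2] on average at every date.
    The excess of the payoffs over the rate [a - e] loses at most [1] at each
    waiting stage and has gained at least [e / 2 * t] after [t] good stages; the
    number [T] of good stages is taken so large that the excess pays for the next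
    wait. The initial excess [M 0] pays for the first one. *)
Lemma uniform_play z a (e : R) : 0 < e -> sustainable z a ->
  exists b C, forall n, (a - e) * n%:R - C <= cumul z b n.
Proof.
move=> e0 za; pose ei i : R := e / 2 / 2 ^+ i.
have ei0 i : 0 < ei i by rewrite divr_gt0// ?divr_gt0// exprn_gt0.
have /choice[M MP] := fun i => sustainable_block (ei0 i.+1).
pose lvl i := a - e / 2 + ei i.
have lvlS i : lvl i - ei i.+1 = lvl i.+1.
  have p0 : 2 ^+ i != 0 :> R by rewrite expf_neq0// pnatr_eq0.
  by rewrite /lvl /ei exprS; field.
have lvl_ge i : a - e / 2 <= lvl i by rewrite lerDl ltW.
have a1 := sustainable_le1 za.
pose excess b (n : nat) : R := cumul z b n - (a - e) * n%:R + (M 0%N)%:R.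
(* A triple (i, (b, L)) stands for i completed blocks, which are the first L
   stages of the play b. *)
pose Inv (x : nat * ((nat -> B) * nat)) :=
  [/\ sustainable (run z x.2.1 x.2.2) (lvl x.1), (x.1 <= x.2.2)%N,
   (M x.1)%:R <= excess x.2.1 x.2.2 &
   forall n, (n <= x.2.2)%N -> 0 <= excess x.2.1 n].
pose Ext (x y : nat * ((nat -> B) * nat)) :=
  [/\ y.1 = x.1.+1, (x.2.2 <= y.2.2)%N &
   forall t, (t < x.2.2)%N -> y.2.1 t = x.2.1 t].
have step (x : {x | Inv x}) : {y : {y | Inv y} | Ext (sval x) (sval y)}.
  apply: cid; case: x => -[i [b L]] /= [/= zs iL Mex ex].
  have [T0 T0P] := natr_large ((M i.+1)%:R / (e / 2)).
  pose T := T0.+1.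
  have [m mM [b' [good sus]]] := MP i T _ _ zs.
  rewrite lvlS in good sus.
  pose c := splice L b b'.
  have cL : run z c L = run z b L by exact: run_splice.
  have tc n : (n <= L)%N -> cumul z c n = cumul z b n.
    move=> nL; apply: eq_cumul => t tn.
    by rewrite /c /splice (leq_trans tn nL).
  have ec n : (n <= L)%N -> excess c n = excess b n.
    by move=> nL; rewrite /excess tc.
  have eL1 n : (n <= m)%N -> excess b L - n%:R <= excess c (L + n)%N.
    move=> nm; rewrite /excess cumulD tc// natrD.
    have := cumul_ge0 (run z c L) (delay c L) n.
    have : (a - e) * n%:R <= n%:R by rewrite -[leRHS]mul1r ler_wpM2r//; lra.
    lra.
  have mMR : m%:R <= (M i)%:R :> R by rewrite ler_nat.
  have eL2 t : (t <= T)%N -> e / 2 * t%:R <= excess c (L + (m + t))%N.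
    move=> tT; have := eL1 m (leqnn _); rewrite /excess.
    rewrite [in X in _ -> X](addnA L) (cumulD _ _ (L + m)) (natrD _ (L + m)).
    rewrite runD cL delay_splice.
    rewrite (_ : delay c (L + m) = delay b' m); last first.
      apply/funext => s; rewrite /delay -addnA.
      by rewrite -/(delay c L _) delay_splice.
    move: mMR Mex; rewrite /excess.
    have := good t tT.
    have : (a - e / 2) * t%:R <= lvl i.+1 * t%:R by rewrite ler_wpM2r.
    lra.
  have MT : (M i.+1)%:R <= e / 2 * T%:R.
    rewrite mulrC -ler_pdivrMr; last lra.
    by apply: (le_trans T0P); rewrite ler_nat.
  have Invy : Inv (i.+1, (c, (L + (m + T))%N)).
    split => /=.
    - by rewrite runD cL delay_splice.
    - by rewrite /T; lia.
    - by apply: le_trans MT _; exact: eL2.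
    - move=> n; have [nL _|Ln nLm] := leqP n L; first by rewrite ec// ex.
      have -> : n = (L + (n - L))%N by lia.
      have [nm|mn] := leqP (n - L) m.
        apply: le_trans (eL1 _ nm); rewrite subr_ge0.
        by apply: le_trans Mex; rewrite ler_nat (leq_trans nm).
      have -> : (n - L = m + (n - L - m))%N by lia.
      apply: le_trans (eL2 _ _); last by lia.
      by rewrite mulr_ge0//; lra.
  exists (exist _ _ Invy); split => //=; first exact: leq_addr.
  by move=> t tL; rewrite /c /splice tL.
have [m0 [b0 _]] := za 0%N.
have Inv0 : Inv (0%N, (b0, 0%N)).
  split => //=.
  - by rewrite /lvl /ei expr0 divr1 subrK.
  - by rewrite /excess /cumul big_geq// mulr0 subrr add0r.
  - by case=> // _; rewrite /excess /cumul big_geq// mulr0 subrr add0r.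
have [f [f0 fS]] := dependent_choice step (exist _ _ Inv0).
pose b i := (sval (f i)).2.1; pose L i := (sval (f i)).2.2.
have fi i : (sval (f i)).1 = i.
  by elim: i => [|i IH]; [rewrite f0|case: (fS i) => -> _ _; rewrite IH].
have iL i : (i <= L i)%N by have [_ + _ _] := svalP (f i); rewrite fi.
have agree i j t : (i <= j)%N -> (t < L i)%N -> b j t = b i t /\ (L i <= L j)%N.
  move=> + ti; elim: j => [|j IH]; first by rewrite leqn0 => /eqP ->.
  rewrite leq_eqVlt ltnS => /predU1P[-> //|/IH[<- Lij]].
  have [_ Lj ej] := fS j; split; last exact: leq_trans Lj.
  by apply: ej; exact: leq_trans Lij.
(* The stages before L i are final in b i, and stage t is among them for
   i = t.+1, as every block is nonempty. *)
exists (fun t => b t.+1 t), (M 0%N)%:R => n.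
have [_ _ _ /(_ n (iL n))] := svalP (f n).
rewrite /excess -/(b n) (@eq_cumul _ (b n) (fun t => b t.+1 t)); first lra.
by move=> t tn; have [] := agree t.+1 n t tn (iL t.+1).
Qed.

Lemma uniform_play_of_average z a (e : R) : 0 < e ->
  (forall N, exists n b, (N <= n)%N /\ a * n%:R <= cumul z b n) ->
  exists b C, forall n, (a - e) * n%:R - C <= cumul z b n.
Proof.
move=> e0 h; have e20 : 0 < e / 2 by lra.
have za : sustainable z (a - e / 2).
  move=> n; have [N NP] := natr_large (n%:R / (e / 2)).
  have [k [b [Nk ab]]] := h N.
  apply: guarantee_of_average ab; first lra.
  rewrite mulrC -ler_pdivrMr//; apply: le_trans NP _.
  by rewrite ler_nat.
have [b [C bC]] := uniform_play e20 za; exists b, C => n.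
by rewrite (_ : a - e = a - e / 2 - e / 2)//; lra.
Qed.
End Control.

(** * Finitely supported distributions *)

Section Expectation.
Variable R : realType.
Implicit Types T U : choiceType.

Lemma fsexp_sub T (p : fsdist R T) (X : {fset T}) F :
  (finsupp p `<=` X)%fset -> fsexp p F = \sum_(x <- X) p x * F x.
Proof.
by move=> pX; apply: big_fset_incl pX _ => x _ xp; rewrite fsfun_dflt ?mul0r.
Qed.

Lemma eq_fsexp T (p : fsdist R T) F G : F =1 G -> fsexp p F = fsexp p G.
Proof. by move=> FG; congr fsexp; apply/funext. Qed.

Lemma fsexp_bind T U (p : fsdist R T) (f : T -> fsdist R U) F :
  fsexp (fsbind p f) F = fsexp p (fun x => fsexp (f x) F).
Proof.
rewrite (@fsexp_sub _ _ (bind_supp p f)); last exact: finsupp_sub.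
under eq_bigr do rewrite /= bind_funE mulr_suml.
rewrite exchange_big /= /fsexp big_seq [RHS]big_seq; apply: eq_bigr => x xp.
rewrite -/(fsexp (f x) F) (@fsexp_sub _ _ (bind_supp p f)).
  by rewrite mulr_sumr; apply: eq_bigr => y _; rewrite mulrA.
by apply/fsubsetP => y yf; apply/bigfcupP; exists x; rewrite ?xp.
Qed.

Lemma fsexp_dirac T (a : T) F : fsexp (fsdirac R a) F = F a.
Proof.
rewrite (@fsexp_sub _ _ [fset a]%fset); last exact: finsupp_sub.
by rewrite big_seq_fset1 /= dirac_funE eqxx mul1r.
Qed.

Lemma fsexp_cst T (p : fsdist R T) c : fsexp p (fun=> c) = c.
Proof. by rewrite /fsexp -mulr_suml fsdist_sum1 mul1r. Qed.

Lemma fsexpD T (p : fsdist R T) F G :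
  fsexp p (fun x => F x + G x) = fsexp p F + fsexp p G.
Proof.
by rewrite /fsexp -big_split; apply: eq_bigr => x _; rewrite mulrDr.
Qed.

Lemma fsexpZ T (p : fsdist R T) c F :
  fsexp p (fun x => c * F x) = c * fsexp p F.
Proof. by rewrite /fsexp mulr_sumr; apply: eq_bigr => x _; rewrite mulrCA. Qed.

Lemma fsexpB T (p : fsdist R T) F G :
  fsexp p (fun x => F x - G x) = fsexp p F - fsexp p G.
Proof.
by rewrite /fsexp -sumrB; apply: eq_bigr => x _; rewrite mulrBr.
Qed.

Lemma fsexp_sum T (I : finType) (p : fsdist R T) (F : I -> T -> R) :
  fsexp p (fun x => \sum_i F i x) = \sum_i fsexp p (F i).
Proof.
by rewrite /fsexp exchange_big; apply: eq_bigr => x _; rewrite mulr_sumr.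
Qed.

Lemma fsexp_exchange T U (p : fsdist R T) (r : fsdist R U) F :
  fsexp p (fun x => fsexp r (F x)) = fsexp r (fun y => fsexp p (F^~ y)).
Proof.
rewrite /fsexp; under eq_bigr do rewrite mulr_sumr.
rewrite exchange_big /=; apply: eq_bigr => y _; rewrite mulr_sumr.
by apply: eq_bigr => x _; rewrite mulrCA.
Qed.

Lemma ler_fsexp T (p : fsdist R T) F G : (forall x, F x <= G x) ->
  fsexp p F <= fsexp p G.
Proof.
by move=> FG; apply: ler_sum => x _; rewrite ler_wpM2l// fsdist_ge0.
Qed.

Lemma fsexp_itv01 T (p : fsdist R T) F : (forall x, 0 <= F x <= 1) ->
  0 <= fsexp p F <= 1.
Proof.
move=> F01; rewrite -{1}(fsexp_cst p 0) -(fsexp_cst p 1).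
by rewrite !ler_fsexp// => x; case/andP: (F01 x).
Qed.

Lemma ler_norm_fsexp T (p : fsdist R T) F c : (forall x, `|F x| <= c) ->
  `|fsexp p F| <= c.
Proof.
move=> Fc; rewrite ler_norml -{1}(fsexp_cst p (- c)) -{2}(fsexp_cst p c).
by rewrite !ler_fsexp// => x; have := Fc x; rewrite ler_norml => /andP[].
Qed.

Lemma indicator_itv01 (b : bool) : 0 <= (b%:R : R) <= 1.
Proof. by case: b; rewrite !lexx ler01. Qed.

Lemma fsexp_fin T (I : finType) (p : fsdist R T) (f : T -> I) (F : I -> R) :
  fsexp p (fun x => F (f x)) = \sum_i fsexp p (fun x => (f x == i)%:R) * F i.
Proof.
under [RHS]eq_bigr do rewrite mulrC -fsexpZ.
rewrite -fsexp_sum; apply: eq_fsexp => x.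
by rewrite (bigD1 (f x))//= eqxx mulr1 big1 ?addr0// => i /negPf;
  rewrite eq_sym => ->; rewrite mulr0.
Qed.

(** Conditioning on the value of [f]: [r u] is the law of [x] given [f x = u],
    and an arbitrary one if this event has probability [0]. In the conclusion
    the first argument of [G] is frozen on the right-hand side, which also says
    that [r u] is concentrated on the points where [f] equals [u]. *)
Lemma disintegration T U (p : fsdist R T) (f : T -> U) :
  exists r : U -> fsdist R T, forall G : U -> T -> R,
  fsexp p (fun x => G (f x) x) = fsexp p (fun x => fsexp (r (f x)) (G (f x))).
Proof.
pose m u := fsexp p (fun x => (f x == u)%:R).
have /choice[r rP] u : exists r : fsdist R T, m u != 0 ->
    forall x, r x = p x * (f x == u)%:R / m u.
  have [->|mu] := eqVneq (m u) 0; first by exists p.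
  pose F : {fsfun T -> R with 0} :=
    [fsfun x in finsupp p => p x * (f x == u)%:R / m u | 0].
  have FE x : F x = p x * (f x == u)%:R / m u.
    by rewrite fsfun_fun; case: ifPn => // xp; rewrite fsfun_dflt ?mul0r.
  have F0 x : 0 <= F x.
    rewrite FE divr_ge0 ?mulr_ge0 ?fsdist_ge0 ?ler0n//.
    by case/andP: (fsexp_itv01 p (fun y => indicator_itv01 (f y == u))).
  suff F1 : \sum_(x <- finsupp F) F x = 1 by exists (FSDist F0 F1).
  have Fp : (finsupp F `<=` finsupp p)%fset by exact: finsupp_sub.
  rewrite (big_fset_incl _ Fp) => [|x _ xF]; last exact: fsfun_dflt.
  by under eq_bigr do rewrite FE; rewrite -mulr_suml divff.
exists r => G.
have m_gt0 x : x \in finsupp p -> m (f x) != 0.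
  rewrite mem_finsupp => px; rewrite gt_eqF//.
  apply: (@lt_le_trans _ _ (p x)); first by rewrite lt_def px fsdist_ge0.
  rewrite /m /fsexp (big_fsetD1 x) ?mem_finsupp//= eqxx mulr1 lerDl.
  by apply: sumr_ge0 => y _; rewrite mulr_ge0 ?fsdist_ge0.
transitivity (\sum_(x <- finsupp p) \sum_(y <- finsupp p)
    p x * (p y * (f y == f x)%:R / m (f x) * G (f x) y)); last first.
  rewrite /fsexp big_seq [RHS]big_seq; apply: eq_bigr => x xp.
  rewrite -mulr_sumr -/(fsexp (r (f x)) (G (f x))); congr (_ * _).
  rewrite (@fsexp_sub _ _ (finsupp p)).
    by apply: eq_bigr => y _; rewrite rP ?m_gt0.
  apply/fsubsetP => y; rewrite !mem_finsupp rP ?m_gt0//.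
  by apply: contraNN => /eqP ->; rewrite !mul0r.
rewrite exchange_big /= /fsexp big_seq [RHS]big_seq.
apply: eq_bigr => y yp.
transitivity (p y * G (f y) y * (m (f y) / m (f y))).
  by rewrite divff ?mulr1 ?m_gt0.
rewrite {1}/m /fsexp mulr_suml mulr_sumr; apply: eq_bigr => x _.
rewrite [f y == _]eq_sym; case: eqP => [->|_]; last by rewrite !(mulr0, mul0r).
by rewrite !mulr1; ring.
Qed.

Definition cond T U (p : fsdist R T) (f : T -> U) : U -> fsdist R T :=
  sval (cid (disintegration p f)).

Lemma fsexp_cond T U (p : fsdist R T) (f : T -> U) (G : U -> T -> R) :
  fsexp p (fun x => G (f x) x) =
  fsexp p (fun x => fsexp (cond p f (f x)) (G (f x))).
Proof. by rewrite /cond; case: cid. Qed.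

(** Rounding each coordinate down to a multiple of [1 / N]; [y d] is the rounded
    vector of the class [d]. *)
Lemma quantization (I : finType) (e : R) : 0 < e ->
  exists (D : finType) (c : (I -> R) -> D) (y : D -> I -> R),
    (forall d i, 0 <= y d i <= 1) /\
    forall x, (forall i, 0 <= x i <= 1) -> forall i, `|x i - y (c x) i| <= e.
Proof.
move=> e0; pose N := (Num.truncn e^-1).+1.
have N0 : 0 < N%:R :> R by rewrite ltr0n.
have Ne : N%:R^-1 <= e.
  rewrite -[leRHS]invrK lef_pV2 ?posrE ?invr_gt0//.
  by rewrite ltW// truncnS_gt.
exists {ffun I -> 'I_N.+1}.
exists (fun x => [ffun i => inord (Num.truncn (N%:R * x i))]).
exists (fun d : {ffun I -> 'I_N.+1} => fun i => (d i)%:R / N%:R).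
split=> [d i|x x01 i].
  by rewrite divr_ge0// ler_pdivrMr// mul1r ler_nat -ltnS ltn_ord.
have /andP[x0 x1] := x01 i.
have /truncn_itv/andP[lo hi] : 0 <= N%:R * x i by rewrite mulr_ge0// ltW.
have tN : (Num.truncn (N%:R * x i) <= N)%N.
  rewrite -(ler_nat R); apply: le_trans lo _.
  by rewrite -[leRHS]mulr1 ler_wpM2l// ltW.
rewrite ffunE inordK//; apply: le_trans Ne.
have Ni : 0 <= N%:R^-1 :> R by rewrite invr_ge0 ltW.
rewrite -[X in X - _](mulKf (lt0r_neq0 N0)) [_^-1 * _]mulrC -mulrBl normrM.
rewrite [X in _ * X]ger0_norm// -[leRHS]mul1r ler_wpM2r//.
rewrite ger0_norm ?subr_ge0//.
by rewrite lerBlDl natr1 ltW.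
Qed.

End Expectation.

(** * Behavioral strategies and the laws of plays *)

Section BehavioralStrategies.
Variables (R : realType) (K : finType) (A S : choiceType).
Variables (q : K -> A -> fsdist R (S * K)%type) (g : K -> A -> R).
Hypothesis g01 : forall k a, 0 <= g k a <= 1.

Local Notation strategy := (strategy R A S).

(** Payoff of the stage following [t] stages, when the current state is [k] and
    the histories given to [s] start now. *)
Fixpoint expected_payoff (t : nat) (s : strategy) (k : K) : R :=
  if t is t'.+1 then
    fsexp (s [::]) (fun a => fsexp (q k a) (fun sk =>
      expected_payoff t' (fun h => s ((a, sk.1) :: h)) sk.2))
  else fsexp (s [::]) (g k).

Lemma expected_payoff_itv01 t s k : 0 <= expected_payoff t s k <= 1.
Proof.
elim: t s k => [|t IH] s k /=; apply: fsexp_itv01 => // a.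
by apply: fsexp_itv01.
Qed.

(** Bayes' rule: the law of the index [j], drawn from [l], given the action that
    was drawn from [s j]. *)
Definition posterior (J : choiceType) (l : fsdist R J) (s : J -> fsdist R A) :
    A -> fsdist R J :=
  let joint := fsbind l (fun j => fsbind (s j) (fun a => fsdirac R (j, a))) in
  fun a => fsbind (cond joint snd a) (fun ja => fsdirac R ja.1).

Lemma fsexp_posterior (J : choiceType) (l : fsdist R J) (s : J -> fsdist R A)
    (G : A -> J -> R) :
  fsexp (fsbind l s) (fun a => fsexp (posterior l s a) (G a)) =
  fsexp l (fun j => fsexp (s j) (G^~ j)).
Proof.
pose joint := fsbind l (fun j => fsbind (s j) (fun a => fsdirac R (j, a))).
have jointE F :
    fsexp joint F = fsexp l (fun j => fsexp (s j) (fun a => F (j, a))).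
  rewrite fsexp_bind; apply: eq_fsexp => j; rewrite fsexp_bind.
  by apply: eq_fsexp => a; rewrite fsexp_dirac.
rewrite -(jointE (fun ja => G ja.2 ja.1)).
rewrite (fsexp_cond joint snd (fun a ja => G a ja.1)) jointE fsexp_bind.
apply: eq_fsexp => j; apply: eq_fsexp => a; rewrite fsexp_bind.
by apply: eq_fsexp => ja; rewrite fsexp_dirac.
Qed.

(** The behavioral strategy equivalent to drawing [j] from [l] and then playing
    [s j]: it draws each action after updating the law of [j] by the past
    actions. The signals carry no information on [j] beyond that of the
    actions. *)
Fixpoint mixture (J : choiceType) (l : fsdist R J) (s : J -> strategy)
    (h : seq (A * S)) : fsdist R A :=
  if h is x :: h' then
    mixture (posterior l (fun j => s j [::]) x.1) (fun j h => s j (x :: h)) h'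
  else fsbind l (fun j => s j [::]).

(** Kuhn's theorem: for every initial state, the mixture has the payoffs of the
    random choice of a strategy. *)
Lemma expected_payoff_mixture (J : choiceType) t (l : fsdist R J) s k :
  expected_payoff t (mixture l s) k =
  fsexp l (fun j => expected_payoff t (s j) k).
Proof.
elim: t l s k => [|t IH] l s k /=; first by rewrite fsexp_bind.
rewrite -(fsexp_posterior l (fun j => s j [::]) (fun a j =>
  fsexp (q k a) (fun sk =>
    expected_payoff t (fun h => s j ((a, sk.1) :: h)) sk.2))).
apply: eq_fsexp => a; rewrite fsexp_exchange.
by apply: eq_fsexp => sk; rewrite -IH.
Qed.

Local Notation law := (fsdist R (play K A S * K)%type).

Definition next_law (s : strategy) (z : law) : law :=
  fsbind z (fun hk => fsbind (s (observed hk.1)) (fun a =>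
    fsbind (q hk.2 a) (fun sk =>
      fsdirac R (rcons hk.1 (hk.2, a, sk.1), sk.2)))).

Definition mean_payoff (s : strategy) (z : law) : R :=
  fsexp z (fun hk => fsexp (s (observed hk.1)) (g hk.2)).

Lemma mean_payoff_itv01 s z : 0 <= mean_payoff s z <= 1.
Proof. by apply: fsexp_itv01 => hk; exact: fsexp_itv01. Qed.

(** What the controls [b], applied from now on, amount to after the observed
    history [h]. *)
Definition continuation (b : nat -> strategy) (h : seq (A * S)) : strategy :=
  fun h' => b (size h') (h ++ h').

(** The control problem runs forward on laws, while [expected_payoff] runs
    backward from a single state; this identifies the two. *)
Lemma stage_expected_payoff (z : law) b t :
  stage next_law mean_payoff z b t =
  fsexp z (fun hk => expected_payoff t (continuation b (observed hk.1)) hk.2).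
Proof.
elim: t z b => [|t IH] z b.
  rewrite /stage /mean_payoff /=.
  by apply: eq_fsexp => hk; rewrite /continuation cats0.
rewrite -add1n stageD IH /= !fsexp_bind; apply: eq_fsexp => hk.
rewrite fsexp_bind /continuation /= cats0; apply: eq_fsexp => a.
rewrite fsexp_bind; apply: eq_fsexp => sk; rewrite fsexp_dirac /=.
congr expected_payoff; apply/funext => h'.
by rewrite /observed map_rcons /delay cat_rcons.
Qed.

(** The controls at date [t] recover the initial history by removing the last
    [t] entries. *)
Lemma continuation_onto (s : seq (A * S) -> strategy) :
  exists b, forall h, continuation b h = s h.
Proof.
exists (fun t h => s (take (size h - t) h) (drop (size h - t) h)) => h.
apply/funext => h'; rewrite /continuation size_cat addnK.
by rewrite take_size_cat// drop_size_cat.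
Qed.

Let obs (hk : play K A S * K) : seq (A * S) := observed hk.1.

Definition belief (z : law) (h : seq (A * S)) (k : K) : R :=
  fsexp (cond z obs h) (fun hk => (hk.2 == k)%:R).

Lemma fsexp_belief z (F : seq (A * S) -> K -> R) :
  fsexp z (fun hk => F (obs hk) hk.2) =
  fsexp z (fun hk => \sum_k belief z (obs hk) k * F (obs hk) k).
Proof.
rewrite (fsexp_cond z obs (fun h hk => F h hk.2)); apply: eq_fsexp => hk.
exact: fsexp_fin.
Qed.

(** The future expected payoff is a function of the history and of the state, so
    by conditioning it is linear in the belief; replacing beliefs by rounded ones
    costs at most [e] per state. *)
Lemma fsexp_belief_approx z (F : seq (A * S) -> K -> R)
    (y : seq (A * S) -> K -> R) (e : R) :
  (forall h k, 0 <= F h k <= 1) ->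
  (forall h k, `|belief z h k - y h k| <= e) ->
  `|fsexp z (fun hk => F (obs hk) hk.2) -
    fsexp z (fun hk => \sum_k y (obs hk) k * F (obs hk) k)| <= e *+ #|K|.
Proof.
move=> F01 ye; rewrite fsexp_belief -fsexpB; apply: ler_norm_fsexp => hk.
rewrite -sumrB -sumr_const; apply: le_trans (ler_norm_sum _ _ _) _.
apply: ler_sum => k _; rewrite -mulrBl normrM -[leRHS]mulr1.
have /andP[F0 F1] := F01 (obs hk) k.
by rewrite ler_pM// ger0_norm.
Qed.

(** The payoffs of a stage are, up to [e / 4], computed with rounded beliefs, and
    then depend on the law only through the masses of the cells and, for each
    cell [d], the mean future payoff [Phi d] of the histories in it. Playing the
    mixture conditional on [d] after every history of [z'] in the cell [d]
    produces the same [Phi d] for [z'], so only the difference of the masses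
    remains, which the second rounding makes small. *)
Lemma simulation_law (e : R) : 0 < e ->
  exists (D : finType) (c : law -> D), forall z z', c z = c z' ->
  forall b, exists b', forall t,
    `|stage next_law mean_payoff z b t - stage next_law mean_payoff z' b' t|
      <= e.
Proof.
move=> e0; pose nK : R := #|K|.+1%:R; have nK0 : 0 < nK by rewrite ltr0n.
pose e1 := e / 4 / nK; have e10 : 0 < e1 by rewrite !divr_gt0.
have [D1 [c1 [y1 [y1_01 c1P]]]] := quantization K e10.
pose nD : R := #|D1|.+1%:R; have nD0 : 0 < nD by rewrite ltr0n.
pose e2 := e1 / nD; have e20 : 0 < e2 by rewrite divr_gt0.
have [D2 [c2 [y2 [_ c2P]]]] := quantization D1 e20.
pose cell z h : D1 := c1 (belief z h).
pose mass z (d : D1) : R := fsexp z (fun hk => (cell z (obs hk) == d)%:R).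
have cellP z h k : `|belief z h k - y1 (cell z h) k| <= e1.
  by apply: c1P => k'; apply: fsexp_itv01 => hk; exact: indicator_itv01.
have massP z d : `|mass z d - y2 (c2 (mass z)) d| <= e2.
  by apply: c2P => d'; apply: fsexp_itv01 => hk; exact: indicator_itv01.
exists D2, (fun z => c2 (mass z)) => z z' zz' b.
pose s h := continuation b h.
pose l := cond z (fun hk => cell z (obs hk)).
have [b' b'P] :=
  continuation_onto (fun h => mixture (l (cell z' h)) (fun hk => s (obs hk))).
exists b' => t; rewrite !stage_expected_payoff.
pose Phi d := fsexp (l d) (fun hk =>
  \sum_k y1 d k * expected_payoff t (s (obs hk)) k).
have Phi_le d : `|Phi d| <= nK.
  apply: ler_norm_fsexp => hk; apply: le_trans (ler_norm_sum _ _ _) _.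
  apply: (@le_trans _ _ (\sum_(k : K) 1)); last first.
    by rewrite sumr_const ler_nat ltnW.
  apply: ler_sum => k _; have /andP[y0 yl] := y1_01 d k.
  have /andP[p0 pl] := expected_payoff_itv01 t (s (obs hk)) k.
  by rewrite ger0_norm ?mulr_ge0// mulr_ile1.
have approx := fsexp_belief_approx (z := z)
  (F := fun h => expected_payoff t (s h)) (y := fun h => y1 (cell z h))
  (fun h k => expected_payoff_itv01 _ _ _) (cellP z).
have approx' := fsexp_belief_approx (z := z')
  (F := fun h => expected_payoff t (continuation b' h))
  (y := fun h => y1 (cell z' h))
  (fun h k => expected_payoff_itv01 _ _ _) (cellP z').
have midE : fsexp z (fun hk => \sum_k y1 (cell z (obs hk)) k *
    expected_payoff t (s (obs hk)) k) = \sum_d mass z d * Phi d.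
  rewrite (fsexp_cond z (fun hk => cell z (obs hk)) (fun d hk =>
    \sum_k y1 d k * expected_payoff t (s (obs hk)) k)).
  exact: (fsexp_fin z (fun hk => cell z (obs hk)) Phi).
have midE' : fsexp z' (fun hk => \sum_k y1 (cell z' (obs hk)) k *
    expected_payoff t (continuation b' (obs hk)) k) = \sum_d mass z' d * Phi d.
  rewrite -(fsexp_fin z' (fun hk => cell z' (obs hk)) Phi).
  apply: eq_fsexp => hk; rewrite b'P /Phi fsexp_sum.
  by apply: eq_bigr => k _; rewrite expected_payoff_mixture fsexpZ.
have mid : `|\sum_d mass z d * Phi d - \sum_d mass z' d * Phi d| <= e / 2.
  rewrite -sumrB; apply: le_trans (ler_norm_sum _ _ _) _.
  apply: (@le_trans _ _ (\sum_(d : D1) (e2 * 2 * nK))).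
    apply: ler_sum => d _; rewrite -mulrBl normrM ler_pM//.
    have := massP z d; have := massP z' d; rewrite zz' !ler_norml.
    by move=> /andP[? ?] /andP[? ?]; apply/andP; split; lra.
  rewrite sumr_const -[_ *+ #|D1|]mulr_natr.
  have -> : e / 2 = e2 * 2 * nK * nD.
    by rewrite /e2 /e1; field; rewrite !gt_eqF.
  rewrite ler_wpM2l//; last by rewrite ler_nat.
  by apply: mulr_ge0; [apply: mulr_ge0|]; rewrite // ltW.
have e1K : e1 *+ #|K| <= e / 4.
  have -> : e / 4 = e1 * nK by rewrite /e1; field; rewrite gt_eqF.
  by rewrite -mulr_natr ler_wpM2l ?ltW// ltr_nat.
move: approx approx' mid; rewrite midE midE' !ler_norml.
by move=> /andP[? ?] /andP[? ?] /andP[? ?]; apply/andP; split; lra.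
Qed.

End BehavioralStrategies.

(** * Upper and lower limits of extended real sequences *)

Section Limits.
Variable R : realType.
Implicit Types u v : (\bar R)^nat.
Local Open Scope ereal_scope.

Lemma limn_esup_le_tail u N :
  limn_esup u <= ereal_sup [set u n | n in [set n | (N <= n)%N]].
Proof.
apply: ereal_inf_lbound; exists [set n | (N <= n)%N]%classic => //.
exact: nbhs_infty_ge.
Qed.

Lemma le_limn_esup u v : (forall n, u n <= v n) -> limn_esup u <= limn_esup v.
Proof.
move=> uv; apply/ereal_infP => _ [V FV <-].
apply: (@le_trans _ _ (ereal_sup [set u n | n in V])).
  by apply: ereal_inf_lbound; exists V.
apply/ereal_supP => _ [n Vn <-]; apply: le_trans (uv n) _.
by apply: ereal_sup_ubound; exists n.
Qed.

Lemma lt_limn_esup u x N : x < limn_esup u -> exists2 n, (N <= n)%N & x < u n.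
Proof.
move=> xu.
have /ereal_sup_gt[_ [n Nn <-] xn] := lt_le_trans xu (limn_esup_le_tail u N).
by exists n.
Qed.

Lemma limn_einf_ge u x N :
  (forall n, (N <= n)%N -> x <= u n) -> x <= limn_einf u.
Proof.
move=> xu; rewrite /limn_einf leeNr; apply: le_trans (limn_esup_le_tail _ N) _.
by apply/ereal_supP => _ [n Nn <-]; rewrite leeN2; exact: xu.
Qed.

Lemma lte_between (x y : \bar R) : x < y -> exists r : R, x < r%:E < y.
Proof.
case: x y => [x| |] [y| |]//.
- rewrite lte_fin => xy; exists ((x + y) / 2)%R; rewrite !lte_fin.
  by apply/andP; split; lra.
- by move=> _; exists (x + 1)%R; rewrite lte_fin ltry andbT; lra.
- by move=> _; exists (y - 1)%R; rewrite lte_fin ltNyr /=; lra.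
- by move=> _; exists 0%R; rewrite ltNyr ltry.
Qed.

End Limits.

(** * The uniform value *)

Section Value.
Variables (R : realType) (K : finType) (A S : choiceType).
Variables (q : K -> A -> fsdist R (S * K)%type) (g : K -> A -> R).
Variable p0 : fsdist R K.
Local Notation strategy := (strategy R A S).

Let z0 := fsbind p0 (fun k : K => fsdirac R ([::] : play K A S, k)).

Lemma gamma_cumul (s : strategy) n :
  gamma q g p0 s n =
  n%:R^-1 * cumul (next_law q) (mean_payoff g) z0 (fun=> s) n.
Proof.
have runE m : run (next_law q) z0 (fun=> s) m = play_law q p0 s m.
  by elim: m => //= m ->.
rewrite /gamma fsexpZ; congr (_ * _).
elim: n => [|n IH].
  rewrite /cumul big_geq// /= fsexp_bind.
  under eq_fsexp do rewrite fsexp_dirac /= big_nil.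
  exact: fsexp_cst.
rewrite /cumul big_nat_recr//= -/(cumul _ _ _ _ _) -IH /stage runE.
rewrite fsexp_bind -fsexpD; apply: eq_fsexp => hk.
rewrite fsexp_bind -[X in X + _](fsexp_cst (s (observed hk.1))) -fsexpD.
apply: eq_fsexp => a; rewrite fsexp_bind -[RHS](fsexp_cst (q hk.2 a)).
by apply: eq_fsexp => sk; rewrite fsexp_dirac big_rcons/= addrC.
Qed.

(** From the empty history, the date is the length of the observed history, so
    one strategy encodes a sequence of controls. *)
Lemma strategy_of_controls (b : nat -> strategy) :
  exists s : strategy, forall n,
  cumul (next_law q) (mean_payoff g) z0 b n =
  cumul (next_law q) (mean_payoff g) z0 (fun=> s) n.
Proof.
exists (continuation b [::]) => n; apply: eq_bigr => t _.
rewrite !stage_expected_payoff !fsexp_bind; apply: eq_fsexp => k.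
by rewrite !fsexp_dirac.
Qed.

End Value.

Theorem theorem6p2 (R : realType) (K : finType) (A S : choiceType)
    (K_nonempty : inhabited K) (A_nonempty : inhabited A)
    (S_nonempty : inhabited S)
    (q : K -> A -> fsdist R (S * K)%type)
    (g : K -> A -> R) (g01 : forall k a, 0 <= g k a <= 1)
    (p0 : fsdist R K) :
  has_uniform_value q g p0.
Proof.
apply/eqP; rewrite eq_le; apply/andP; split.
  apply/ereal_supP => _ [s _ <-]; apply: le_trans (limn_einf_sup _) _.
  by apply: le_limn_esup => n; apply: ereal_sup_ubound; exists s.
rewrite leNgt; apply/negP => /lte_between[r1 /andP[lo]].
(* The room between r1 and r2 is what the construction of the play may lose. *)
move=> /lte_between[r2 /andP[]]; rewrite lte_fin => r12 hi.
pose e := (r2 - r1) / 2; have e0 : 0 < e by rewrite /e; lra.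
have [|b [C bC]] := uniform_play_of_average (mean_payoff_itv01 g01)
    (simulation_law q g01) (z := fsbind p0 (fun k => fsdirac R ([::], k)))
    (a := r2) e0.
  move=> N; have [n Nn] := lt_limn_esup N.+1 hi.
  move=> /ereal_sup_gt[_ [s _ <-]]; rewrite lte_fin gamma_cumul => r2n.
  exists n, (fun=> s); split; first exact: ltnW.
  rewrite -ler_pdivlMr ?ltr0n ?(leq_trans _ Nn)// [_ / _]mulrC.
  exact: ltW.
have [s sE] := strategy_of_controls q g p0 b.
have [N NC] := natr_large (C / e).
move: lo; apply/negP; rewrite -leNgt.
apply: (@le_trans _ _ (limn_einf (fun n => (gamma q g p0 s n)%:E))); last first.
  by apply: ereal_sup_ubound; exists s.
apply: (@limn_einf_ge _ _ _ N.+1) => n Nn; rewrite lee_fin gamma_cumul -sE.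
have n0 : 0 < n%:R :> R by rewrite ltr0n (leq_trans _ Nn).
rewrite mulrC ler_pdivlMr//; apply: le_trans (bC n).
have : C <= e * n%:R.
  by rewrite mulrC -ler_pdivrMr// (le_trans NC)// ler_nat ltnW.
by rewrite /e; lra.
Qed.
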